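(* Let $\gamma:[a,b]\to\mathbb{R}^2$ be an infinitely smooth immersed plane curve, and let $\varphi(\gamma):[a,b]\to\mathbb{R}^2$ be the curve $\varphi(\gamma)(t)=\gamma(t)+\frac{\dot\gamma(t)}{\|\dot\gamma(t)\|}$. Then $\mathrm{Len}(\varphi(\gamma))\ge \mathrm{Len}(\gamma)$.
   Context: $\mathrm{Len}$ denotes the Euclidean length of a parametrized curve; immersed means $\dot\gamma(t)\ne 0$ for all $t$. *)

(* Defs.v *)
From mathcomp Require Import all_boot all_order all_algebra.
From mathcomp Require Import all_classical all_reals all_analysis.
Import Order.TTheory GRing.Theory Num.Theory.
Import numFieldNormedType.Exports.

Set Implicit Arguments.
Unset Strict Implicit.
Unset Printing Implicit Defensive.

Local Open Scope classical_set_scope.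
Local Open Scope ring_scope.

(* The library norm on 'rV[R]_2 is the sup norm, hence the explicit formula. *)
Definition enorm (R : realType) (v : 'rV[R]_2) : R :=
  Num.sqrt (\sum_(i < 2) v 0 i ^+ 2).

(* A curve [a, b] -> R^2 is a function on all of R whose values outside [a, b]
   are never used: derivatives are taken within [a, b], so they are one-sided
   at a and at b. *)
Definition itv_dnbhs (R : realType) (a b t : R) : set_system R :=
  within `[a, b] t^'.

Definition diff_quot (R : realType) (f : R -> 'rV[R]_2) (t s : R) : 'rV[R]_2 :=
  (s - t)^-1 *: (f s - f t).

Definition itv_derivable (R : realType) (a b : R) (f : R -> 'rV[R]_2) (t : R) :
  Prop := cvg (diff_quot f t s @[s --> itv_dnbhs a b t]).

Definition itv_derive (R : realType) (a b : R) (f : R -> 'rV[R]_2) (t : R) :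
  'rV[R]_2 := lim (diff_quot f t s @[s --> itv_dnbhs a b t]).

Definition itv_smooth (R : realType) (a b : R) (f : R -> 'rV[R]_2) : Prop :=
  forall (n : nat) (t : R), t \in `[a, b] ->
    itv_derivable a b (iter n (itv_derive a b) f) t.

Definition immersed (R : realType) (a b : R) (f : R -> 'rV[R]_2) : Prop :=
  forall t : R, t \in `[a, b] -> itv_derive a b f t != 0.

(* As for [variation] in numfun, the partition a < s_0 < ... < s_m = b is listed
   without its first point a. *)
Definition polygon_length (R : realType) (a b : R) (f : R -> 'rV[R]_2)
    (s : seq R) : R :=
  \sum_(0 <= i < size s) enorm (f (nth b (a :: s) i.+1) - f (nth b (a :: s) i)).

Definition curve_length (R : realType) (a b : R) (f : R -> 'rV[R]_2) : \bar R :=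
  ereal_sup [set (polygon_length a b f s)%:E | s in itv_partition a b].

Definition phi (R : realType) (a b : R) (f : R -> 'rV[R]_2) (t : R) :
  'rV[R]_2 := f t + (enorm (itv_derive a b f t))^-1 *: itv_derive a b f t.

(* Main.v *)
Require Import Defs.
From mathcomp Require Import all_boot all_order all_algebra.
From mathcomp Require Import all_classical all_reals all_analysis.
From mathcomp Require Import ring lra.
Import Order.TTheory GRing.Theory Num.Theory.
Import numFieldNormedType.Exports.

Local Open Scope classical_set_scope.
Local Open Scope ring_scope.

(** With [T] the unit tangent of [gamma], the derivative of [gamma + T] is
    [gamma' + T'], and [T'] is orthogonal to [T] because [T] has constant length.
    So the component of the new velocity along [T] is the old speed, and the new
    curve is at every moment at least as fast as the old one.

    Length being a supremum over inscribed polygons, this is carried out on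
    chords, without integrating the speed. Near each [t], a chord of
    [phi gamma] ending at the parameter [t] is at least as long as the one of
    [gamma] up to an error [e * |s - t|] ([chord_phi_near]): one measures it
    along [T t], where [T s - T t] only contributes at second order
    ([dot_unit_diff], [enorm_shifted_chord]). Such an infinitesimal comparison
    of two curves propagates to any parameter interval [[c, d]]: some polygon
    inscribed in the second curve is at least as long as the chord of the first,
    up to [e * (d - c)] ([inscribed_length_ge_chord_local]), since these
    comparisons can be concatenated and a supremum argument rules out that they
    stop before [d]. Concatenating along a partition of [[a, b]] compares every
    polygon inscribed in [gamma] with one inscribed in [phi gamma], up to
    [e * (b - a)] with [e] arbitrary. *)

(** * Euclidean geometry of the plane *)

Definition dot {R : realType} (u v : 'rV[R]_2) : R :=
  \sum_(i < 2) u 0 i * v 0 i.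

Section Euclidean.
Context {R : realType}.
Implicit Types (u v w : 'rV[R]_2) (k : R).

Lemma dotC u v : dot u v = dot v u.
Proof. by apply: eq_bigr => i _; rewrite mulrC. Qed.

Lemma dotDl u v w : dot (u + v) w = dot u w + dot v w.
Proof. by rewrite -big_split; apply: eq_bigr => i _; rewrite mxE mulrDl. Qed.

Lemma dotZl k u v : dot (k *: u) v = k * dot u v.
Proof. by rewrite /dot mulr_sumr; apply: eq_bigr => i _; rewrite mxE mulrA. Qed.

Lemma dotZr k u v : dot u (k *: v) = k * dot u v.
Proof. by rewrite dotC dotZl dotC. Qed.

Lemma dotBl u v w : dot (u - v) w = dot u w - dot v w.
Proof. by rewrite dotDl -scaleN1r dotZl mulN1r. Qed.

Lemma dotBr u v w : dot w (u - v) = dot w u - dot w v.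
Proof. by rewrite dotC dotBl !(dotC w). Qed.

Lemma dot_ge0 u : 0 <= dot u u.
Proof. by apply: sumr_ge0 => i _; rewrite -expr2 sqr_ge0. Qed.

Lemma enorm_ge0 u : 0 <= enorm u.
Proof. exact: sqrtr_ge0. Qed.

Lemma sqr_enorm u : enorm u ^+ 2 = dot u u.
Proof.
have -> : enorm u = Num.sqrt (dot u u).
  by congr Num.sqrt; apply: eq_bigr => i _; rewrite expr2.
by rewrite sqr_sqrtr ?dot_ge0.
Qed.

Lemma enorm_gt0 u : u != 0 -> 0 < enorm u.
Proof.
move=> u0; rewrite lt_neqAle enorm_ge0 andbT eq_sym.
apply: contraNneq u0 => eu0; apply/eqP/rowP => i; rewrite mxE.
have /eqP := sqr_enorm u; rewrite eu0 expr0n eq_sym psumr_eq0 => [|j _].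
  by move=> /allP/(_ i (mem_index_enum _)) /=; rewrite mulf_eq0 orbb => /eqP.
by rewrite -expr2 sqr_ge0.
Qed.

Lemma enormZ k u : enorm (k *: u) = `|k| * enorm u.
Proof.
apply/eqP; rewrite -(@eqrXn2 _ 2) ?mulr_ge0 ?enorm_ge0 //.
by rewrite exprMn !sqr_enorm dotZl dotZr real_normK ?num_real// mulrA.
Qed.

Lemma enorm_normalize u : u != 0 -> enorm ((enorm u)^-1 *: u) = 1.
Proof.
move=> /enorm_gt0 u0; rewrite enormZ gtr0_norm ?invr_gt0//.
by rewrite mulVf ?gt_eqF.
Qed.

(** This is the Cauchy-Schwarz inequality; the defect in Lagrange's identity is
    the squared determinant of [u] and [v]. *)
Lemma dot_le_enorm u v : dot u v <= enorm u * enorm v.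
Proof.
apply: (le_trans (ler_norm _)).
rewrite -(@ler_pXn2r _ 2) ?nnegrE ?mulr_ge0 ?enorm_ge0//.
rewrite exprMn !sqr_enorm real_normK ?num_real// -subr_ge0.
suff -> : dot u u * dot v v - dot u v ^+ 2 =
          (u 0 0 * v 0 1 - u 0 1 * v 0 0) ^+ 2 by exact: sqr_ge0.
by rewrite /dot !big_ord_recl !big_ord0 (_ : lift ord0 ord0 = 1) ?ord1 //;
  [ring | exact: val_inj].
Qed.

Lemma ler_enormD u v : enorm (u + v) <= enorm u + enorm v.
Proof.
rewrite -(@ler_pXn2r _ 2) ?nnegrE ?addr_ge0 ?enorm_ge0//.
rewrite sqrrD !sqr_enorm dotDl !(dotC _ (u + v)) !dotDl (dotC v u).
have := dot_le_enorm u v; lra.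
Qed.

Lemma enormN u : enorm (- u) = enorm u.
Proof. by rewrite -scaleN1r enormZ normrN1 mul1r. Qed.

Lemma ler_enorm_sub u v : enorm u - enorm v <= enorm (u - v).
Proof. by rewrite lerBlDr (le_trans _ (ler_enormD _ _))// subrK. Qed.

Lemma enorm_le_norm u : enorm u <= 2 * `|u|.
Proof.
have coord i : `|u 0 i| <= `|u|.
  by rewrite [leRHS]mx_normrE; exact: (le_bigmax _ (fun ij => `|u ij.1 ij.2|) (0, i)).
have n0 : 0 <= 2 * `|u| by rewrite mulr_ge0.
rewrite -(@ler_pXn2r _ 2) ?nnegrE ?enorm_ge0// sqr_enorm.
rewrite (@le_trans _ _ (\sum_(i < 2) `|u| ^+ 2))//.
  apply: ler_sum => i _.
  by rewrite -expr2 -real_normK ?num_real// ler_pXn2r ?nnegrE.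
rewrite sumr_const card_ord exprMn mulr2n; have := sqr_ge0 `|u|; lra.
Qed.

(** Normalization is Lipschitz away from the origin: in units of [enorm q],
    rescaling [p] to the length of [q] costs at most [enorm (p - q)], and so
    does moving from [p] to [q] without rescaling. *)
Lemma enorm_normalizeB (p q : 'rV[R]_2) : p != 0 -> q != 0 ->
  enorm ((enorm p)^-1 *: p - (enorm q)^-1 *: q) <= 2 * enorm (p - q) / enorm q.
Proof.
move=> /enorm_gt0 p0 /enorm_gt0 q0.
have -> : (enorm p)^-1 *: p - (enorm q)^-1 *: q =
  ((enorm p)^-1 - (enorm q)^-1) *: p + (enorm q)^-1 *: (p - q).
  by rewrite scalerBl scalerBr addrA subrK.
rewrite (le_trans (ler_enormD _ _))// !enormZ (gtr0_norm (_ : 0 < _^-1)) ?invr_gt0//.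
have -> : `|(enorm p)^-1 - (enorm q)^-1| * enorm p =
          `|enorm q - enorm p| / enorm q.
  rewrite -[X in _ * X](gtr0_norm p0) -[X in _ / X](gtr0_norm q0) -normfV -!normrM.
  by congr `|_|; field; rewrite !gt_eqF.
have : `|enorm q - enorm p| <= enorm (p - q).
  have := ler_enorm_sub p q; have := ler_enorm_sub q p.
  by rewrite -(enormN (q - p)) opprB ler_norml => ? ?; apply/andP; split; lra.
rewrite [(enorm q)^-1 * _]mulrC -mulrDl ler_pM2r ?invr_gt0//; lra.
Qed.

(** Two unit vectors and their difference form an isosceles triangle, so moving
    on the unit circle changes the component along the starting vector only to
    second order: the derivative of a unit field is orthogonal to the field. *)
Lemma dot_unit_diff u v : enorm u = 1 -> enorm v = 1 ->
  dot (u - v) v = - (enorm (u - v) ^+ 2 / 2).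
Proof.
move=> u1 v1; have := sqr_enorm u; have := sqr_enorm v.
rewrite u1 v1 sqr_enorm !dotBr !dotBl (dotC v u); lra.
Qed.

End Euclidean.

(** * Curves and their derivatives *)

(** Multiplying the difference quotient out gives a form of differentiability
    that also makes sense at [s = t], so that the punctured filter disappears. *)
Lemma itv_derivable_near (R : realType) (a b t e : R) (f : R -> 'rV[R]_2) :
  itv_derivable a b f t -> 0 < e ->
  \forall s \near t, s \in `[a, b] ->
    enorm (f s - f t - (s - t) *: itv_derive a b f t) <= e * `|s - t|.
Proof.
move=> df e0.
have e20 : 0 < e / 2 by rewrite divr_gt0.
have /cvgr_dist_le/(_ _ e20) near_quot := df.
rewrite /itv_dnbhs /within /dnbhs /= in near_quot.
near=> s => sab.
have [->|st] := eqVneq s t.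
  by rewrite !subrr scale0r subr0 normr0 mulr0 -(scale0r 0) enormZ normr0 mul0r.
have quot : `|itv_derive a b f t - diff_quot f t s| <= e / 2.
  by move: st sab; near: s.
have -> : f s - f t - (s - t) *: itv_derive a b f t =
  (s - t) *: (diff_quot f t s - itv_derive a b f t).
  by rewrite scalerBr /diff_quot scalerA mulfV ?subr_eq0// scale1r.
rewrite enormZ mulrC ler_wpM2r// (le_trans (enorm_le_norm _))//.
by rewrite mulrC -ler_pdivlMr// distrC.
Unshelve. all: by end_near. Qed.

(** Translating a chord [D] of a curve by the change [P - Q] of the unit tangent
    shortens it at most to second order: measured along [Q], oriented by the
    sign of [h], the translation only contributes the second-order term of
    [dot_unit_diff], while [D] itself loses at most the error of its linear
    approximation [h *: q]. *)
Lemma enorm_shifted_chord (R : realType) (D p q : 'rV[R]_2) (h r K : R) :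
  let P := (enorm p)^-1 *: p in let Q := (enorm q)^-1 *: q in
  p != 0 -> q != 0 ->
  enorm (D - h *: q) <= r * `|h| -> enorm (p - q) <= K * `|h| ->
  enorm D - 2 * r * `|h| - 2 * (K / enorm q) ^+ 2 * `|h| ^+ 2
    <= enorm (D + (P - Q)).
Proof.
move=> P Q p0 q0 Dh pq.
have nq0 := enorm_gt0 _ q0.
have W2 : enorm (P - Q) ^+ 2 / 2 <= 2 * (K / enorm q) ^+ 2 * `|h| ^+ 2.
  have W : enorm (P - Q) <= 2 * (K / enorm q) * `|h|.
    rewrite (le_trans (enorm_normalizeB _ _ p0 q0))// -mulrA -[leRHS]mulrA.
    by rewrite ler_pM2l// mulrAC ler_wpM2r// invr_ge0 ltW.
  rewrite ler_pdivrMr//.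
  have -> : 2 * (K / enorm q) ^+ 2 * `|h| ^+ 2 * 2 =
            (2 * (K / enorm q) * `|h|) ^+ 2 by ring.
  by rewrite ler_pXn2r ?nnegrE ?enorm_ge0// (le_trans (enorm_ge0 _) W).
(* The direction of measurement; the sign covers chords to the left. *)
pose E := Num.sg h *: Q.
have E1 : enorm E <= 1.
  by rewrite enormZ enorm_normalize// mulr1 normr_sg; case: (h != 0).
have along u : dot u E <= enorm u.
  by rewrite (le_trans (dot_le_enorm _ _))// ler_piMr// enorm_ge0.
have main_term : dot (h *: q) E = `|h| * enorm q.
  rewrite dotZl !dotZr -sqr_enorm mulrA (mulrC h) -normrEsg.
  by congr (_ * _); rewrite expr2 mulKf// gt_eqF.
have linear_error : - (r * `|h|) <= dot (D - h *: q) E.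
  rewrite lerNl (le_trans _ Dh)// -mulN1r -dotZl scaleN1r.
  by rewrite (le_trans (along _))// enormN.
have shift_error : - (enorm (P - Q) ^+ 2 / 2) <= dot (P - Q) E.
  rewrite dotZr dot_unit_diff ?enorm_normalize// mulrN lerN2.
  rewrite -[leRHS]mul1r ler_wpM2r ?divr_ge0 ?sqr_ge0//.
  by rewrite (le_trans (ler_norm _))// normr_sg; case: (h != 0).
have dsum : dot (D + (P - Q)) E =
  dot (D - h *: q) E + dot (h *: q) E + dot (P - Q) E.
  by rewrite -!dotDl subrK.
have upper : enorm D <= r * `|h| + `|h| * enorm q.
  have -> : D = D - h *: q + h *: q by rewrite subrK.
  by rewrite (le_trans (ler_enormD _ _))// enormZ lerD.
have := along (D + (P - Q)); rewrite dsum main_term => total.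
move: W2 linear_error shift_error upper total.
move: (dot (D - _) E) (dot (P - Q) E) (enorm _ ^+ 2 / 2) (2 * _ * _).
move: (enorm D) (enorm (D + _)) (`|h| * enorm q); rewrite -(mulrA 2).
move: (r * `|h|); clear => *; lra.
Qed.

(** Since [f'] is itself differentiable at [t], it moves by at most a multiple of
    [s - t], which makes the second-order loss of [enorm_shifted_chord] smaller
    than any given [e * |s - t|] near [t]. *)
Lemma chord_phi_near (R : realType) (a b t e : R) (f : R -> 'rV[R]_2) :
  let f' := itv_derive a b f in
  itv_derivable a b f t -> itv_derivable a b f' t ->
  (forall s, s \in `[a, b] -> f' s != 0) ->
  t \in `[a, b] -> 0 < e ->
  \forall s \near t, s \in `[a, b] ->
    enorm (f s - f t) - e * `|s - t| <= enorm (phi a b f s - phi a b f t).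
Proof.
move=> f' df ddf f'0 tab e0.
set q := f' t; set K := 1 + enorm (itv_derive a b f' t).
have q0 : q != 0 by exact: f'0.
have K0 : 0 < K by rewrite ltr_wpDr ?enorm_ge0.
set C := 2 * (K / enorm q) ^+ 2.
have C0 : 0 < C by rewrite mulr_gt0// exprn_gt0// divr_gt0// enorm_gt0.
(* Half of [e] pays for the linearization error of the chord, which is counted
   twice, and half for the second-order term. *)
have e2C : 0 < e / 2 / C by rewrite !divr_gt0.
have e4 : 0 < e / 4 by rewrite divr_gt0.
have near_t : \forall s \near t, `|s - t| <= e / 2 / C.
  apply/nbhs_ballP; exists (e / 2 / C) => //= s.
  by rewrite /ball /= distrC => /ltW.
apply: filterS3 near_t (itv_derivable_near _ _ _ _ _ _ df e4)
  (itv_derivable_near _ _ _ _ _ _ ddf ltr01) => s sC fs f's sab.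
have {}f's : enorm (f' s - q) <= K * `|s - t|.
  rewrite -[f' s - q](subrK ((s - t) *: itv_derive a b f' t)).
  rewrite (le_trans (ler_enormD _ _))// enormZ mulrDl.
  by rewrite [enorm _ * _]mulrC lerD// f's.
have -> : phi a b f s - phi a b f t = f s - f t +
    ((enorm (f' s))^-1 *: f' s - (enorm q)^-1 *: q).
  by rewrite addrACA opprD.
apply: le_trans (enorm_shifted_chord _ _ _ _ _ _ _ (f'0 _ sab) q0 (fs sab) f's).
have Ch : C * `|s - t| ^+ 2 <= e / 2 * `|s - t|.
  by rewrite expr2 mulrA ler_wpM2r// mulrC -ler_pdivlMr.
rewrite -addrA -opprD lerD2l lerN2.
have -> : e * `|s - t| = 2 * (e / 4) * `|s - t| + e / 2 * `|s - t| by field.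
by rewrite lerD2l.
Qed.

(** * Comparing lengths *)

Section Polygons.
Context {R : realType}.
Implicit Types (f g : R -> 'rV[R]_2) (s : seq R).

Lemma polygon_length_nil c d f : polygon_length c d f [::] = 0.
Proof. by rewrite /polygon_length big_geq. Qed.

Lemma polygon_length_cons c d f x s :
  polygon_length c d f (x :: s) = enorm (f x - f c) + polygon_length x d f s.
Proof. by rewrite /polygon_length /= big_nat_recl. Qed.

Lemma polygon_length_cat c d e f s1 s2 : itv_partition c d s1 ->
  polygon_length c e f (s1 ++ s2) =
  polygon_length c d f s1 + polygon_length d e f s2.
Proof.
case=> _ /eqP; elim: s1 c => [c /= ->|x s1 IH c /= /IH sd].
  by rewrite polygon_length_nil add0r.
by rewrite !polygon_length_cons sd addrA.
Qed.

(** Lower bounds on the length are certified by one polygon rather than stated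
    for the supremum [curve_length], so that they add up under concatenation
    without any arithmetic on suprema in the extended reals. *)
Definition inscribed_length_ge f c d x :=
  exists2 s, itv_partition c d s & x <= polygon_length c d f s.

Lemma inscribed_length_ge_cat f c d e x y :
  inscribed_length_ge f c d x -> inscribed_length_ge f d e y ->
  inscribed_length_ge f c e (x + y).
Proof.
move=> [s cs xs] [s' ds' ys']; exists (s ++ s').
  exact: itv_partition_cat cs ds'.
by rewrite (polygon_length_cat _ _ _ _ _ _ cs) lerD.
Qed.

Lemma inscribed_length_ge_le f c d x y : y <= x ->
  inscribed_length_ge f c d x -> inscribed_length_ge f c d y.
Proof. by move=> yx [s cs xs]; exists s => //; exact: le_trans xs. Qed.

Lemma inscribed_length_ge_chord f c d : c <= d ->
  inscribed_length_ge f c d (enorm (f d - f c)).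
Proof.
rewrite le_eqVlt => /predU1P[->|cd].
  exists [::]; first by split.
  by rewrite polygon_length_nil subrr -(scale0r 0) enormZ normr0 mul0r.
exists [:: d]; first exact: itv_partition1.
by rewrite polygon_length_cons polygon_length_nil addr0.
Qed.

(** Real induction: the points [x] such that [g] has an inscribed polygon over
    [[c, x]] that is long enough to compare with the chord of [f] form a
    nonempty set; at its supremum the local hypothesis reaches a little to the
    left, to meet the set, and a little to the right, to leave it. *)
Lemma inscribed_length_ge_chord_local f g c d e : c <= d ->
  (forall t, t \in `[c, d] -> \forall s \near t, s \in `[c, d] ->
    enorm (f s - f t) - e * `|s - t| <= enorm (g s - g t)) ->
  inscribed_length_ge g c d (enorm (f d - f c) - e * (d - c)).
Proof.
move=> cd local.
pose good x y := inscribed_length_ge g x y (enorm (f y - f x) - e * (y - x)).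
have good_trans x y z : good x y -> good y z -> good x z.
  move=> xy yz; apply: inscribed_length_ge_le (inscribed_length_ge_cat _ _ _ _ _ _ xy yz).
  have : enorm (f z - f x) <= enorm (f z - f y) + enorm (f y - f x).
    by rewrite (le_trans _ (ler_enormD _ _))// addrA subrK.
  lra.
have good_chord x y : x <= y ->
    enorm (f y - f x) - e * (y - x) <= enorm (g y - g x) -> good x y.
  by move=> xy h; exact: inscribed_length_ge_le h (inscribed_length_ge_chord _ _ _ xy).
pose S := [set x | x \in `[c, d] /\ good c x].
have Sc : S c.
  split; first by rewrite in_itv /= lexx.
  apply: good_chord => //.
  by rewrite !subrr -(scale0r 0) enormZ normr0 mulr0 mul0r subr0.
have Sub : ubound S d by move=> x [+ _]; rewrite in_itv => /andP[].
have Ssup : has_sup S by split; [exists c | exists d].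
set t := sup S.
have tcd : t \in `[c, d].
  by rewrite in_itv /= ge_sup ?ub_le_sup//; [exists d | exists c].
have /nbhs_ballP[r /= r0 rball] := local t tcd.
have [x [xcd cx] tx] := sup_adherent r0 Ssup.
have xt : x <= t by apply: ub_le_sup => //; exists d.
have ct : good c t.
  apply: good_trans cx _; apply: good_chord => //.
  have := rball x _ xcd; rewrite /ball /= distrC.
  rewrite (ler0_norm (_ : x - t <= 0)) ?subr_le0// opprB => /(_ _).
  rewrite -(enormN (f x - f t)) -(enormN (g x - g t)) !opprB; apply.
  by move: tx; rewrite -/t; lra.
suff <- : t = d by [].
apply/eqP; rewrite eq_le; move: (tcd); rewrite in_itv /= => /andP[ct' ->] /=.
rewrite leNgt; apply/negP => td.
pose y := Num.min d (t + r / 2).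
have ty : t < y by rewrite lt_min td ltrDl divr_gt0.
have yd : y <= d by rewrite ge_min lexx.
have yr : y <= t + r / 2 by rewrite ge_min lexx orbT.
have ycd : y \in `[c, d] by rewrite in_itv /= yd andbT; lra.
have : S y.
  split => //; apply: good_trans ct _; apply: good_chord; first exact: ltW.
  have := rball y _ ycd; rewrite /ball /= distrC gtr0_norm ?subr_gt0//.
  by apply; lra.
by move=> Sy; have := ub_le_sup (ex_intro _ d Sub) Sy; rewrite leNgt ty.
Qed.

(** The chord comparison on each piece of a partition, concatenated. *)
Lemma inscribed_length_ge_local f g a b e s : itv_partition a b s ->
  (forall t, t \in `[a, b] -> \forall s \near t, s \in `[a, b] ->
    enorm (f s - f t) - e * `|s - t| <= enorm (g s - g t)) ->
  inscribed_length_ge g a b (polygon_length a b f s - e * (b - a)).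
Proof.
elim: s a => [|x s IH] a ps local.
  have ab := itv_partition_nil ps; subst a.
  exists [::] => //; rewrite !polygon_length_nil; lra.
have ax : a < x by case: ps => /= /andP[].
have ps' := itv_partition_cons ps.
have xb := itv_partition_le ps'.
have restrict a' b' : a <= a' -> b' <= b ->
    forall t, t \in `[a', b'] -> \forall s \near t, s \in `[a', b'] ->
    enorm (f s - f t) - e * `|s - t| <= enorm (g s - g t).
  move=> aa bb t.
  have sub : {subset `[a', b'] <= `[a, b]}.
    by apply/subitvP; rewrite subitvE !bnd_simp aa bb.
  move=> /sub/local; apply: filterS => u + /sub; exact.
apply: inscribed_length_ge_le (inscribed_length_ge_cat _ _ _ _ _ _
  (inscribed_length_ge_chord_local _ _ _ _ _ (ltW ax) (restrict _ _ (lexx a) xb))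
  (IH _ ps' (restrict _ _ (ltW ax) (lexx b)))).
rewrite polygon_length_cons; lra.
Qed.

End Polygons.

Theorem lemma2p1 (R : realType) (a b : R) (gamma : R -> 'rV[R]_2)
  (lt_ab : a < b)
  (gamma_smooth : itv_smooth a b gamma)
  (gamma_immersed : immersed a b gamma) :
  (curve_length a b gamma <= curve_length a b (phi a b gamma))%E.
Proof.
apply: ge_ereal_sup => _ [s ps <-].
apply/lee_subgt0Pr => e e0.
have ba0 : 0 < b - a by rewrite subr_gt0.
have [|s' ps' le_s'] := inscribed_length_ge_local gamma (phi a b gamma) a b
  (e / (b - a)) s ps.
  move=> t tab; apply: chord_phi_near => //; last by rewrite divr_gt0.
  - exact: (gamma_smooth 0%N).
  - exact: (gamma_smooth 1%N).
apply: (@le_trans _ _ (polygon_length a b (phi a b gamma) s')%:E).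
  by rewrite -EFinB lee_fin (le_trans _ le_s')// divfK// gt_eqF.
by apply: ereal_sup_ubound; exists s'.
Qed.
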